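(* Let $K=\mathbb C$, $V$ a finite-dimensional $K$-vector space, and let $G\leqslant\mathrm{GL}(V)$ be a finite group generated by pseudo-reflections, some of which have order $\geq3$. Then $\overline A=A/AeA$ is not an endomorphism ring over $R/(\Delta)$; that is, there is no finitely generated $R/(\Delta)$-module $M$ with $\overline A\cong\mathrm{End}_{R/(\Delta)}(M)$ as $R/(\Delta)$-algebras.
   Context: $S=\mathrm{Sym}_K(V)=K[x_1,\dots,x_n]$ with induced $G$-action; a pseudo-reflection is an element conjugate to $\mathrm{diag}(\zeta,1,\dots,1)$, $\zeta\ne1$ a root of unity. $R=S^G=K[f_1,\dots,f_n]$, a polynomial ring on homogeneous basic invariants. For each mirror (fixed hyperplane) $H$ of a pseudo-reflection in $G$, let $\rho_H$ be the order of the cyclic subgroup of $G$ fixing $H$ pointwise and $L_H\in V=S_1$ a vector spanning $\mathrm{Im}(s-1)$ for a pseudo-reflection $s\in G$ with mirror $H$; $\Delta=\prod_HL_H^{\rho_H}\in R$ is the discriminant. $A=S*G$ is the free left $S$-module on $\{\delta_g\}_{g\in G}$ with $(s'\delta_{g'})(s\delta_g)=s'g'(s)\delta_{g'g}$; $e=\frac1{|G|}\sum_g\delta_g$. $\overline A$ is annihilated by $\Delta$ and hence is an $R/(\Delta)$-algebra. *)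

(* Defs.v *)
From HB Require Import structures.
From mathcomp Require Import all_boot all_order all_fingroup all_algebra finmap.
From mathcomp Require Import mpoly.
From mathcomp Require Import boolp generic_quotient.

Set Implicit Arguments.
Unset Strict Implicit.
Unset Printing Implicit Defensive.

Import GRing.Theory.
Local Open Scope ring_scope.
Local Open Scope quotient_scope.

(* MathComp only divides commutative rings by proper ideals, because its
   quotient rings must be nontrivial.  Here the ring need not be commutative
   and the ideal may be the whole ring. *)

HB.mixin Record isIdeal2 (R : pzRingType) (I : R -> bool) := {
  ideal2Ml : forall a x, x \in I -> a * x \in I;
  ideal2Mr : forall a x, x \in I -> x * a \in I
}.

#[short(type="ideal2")]
HB.structure Definition Ideal2 (R : pzRingType) :=
  {I of GRing.ZmodClosed R I & isIdeal2 R I}.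

Definition rquot (R : pzRingType) (I : ideal2 R) : Type := Quotient.quot I.

Definition rclass (R : pzRingType) (I : ideal2 R) (a : R) : rquot I :=
  \pi_(Quotient.quot I) a.
Arguments rclass {R} I a.

Section RingQuotient.
Variables (R : pzRingType) (I : ideal2 R).
Local Notation Q := (rquot I).
Local Notation cl := (rclass I).

HB.instance Definition _ := GRing.Zmodule.on Q.

Lemma rclassP a b : reflect (cl a = cl b) (a - b \in I).
Proof. by rewrite Quotient.idealrBE; apply: eqP. Qed.

Definition rrepr (x : Q) : R := repr (x : Quotient.quot I).

Lemma rreprK : cancel rrepr cl. Proof. by move=> x; apply: reprK. Qed.

Lemma rrepr_class a : a - rrepr (cl a) \in I.
Proof. by apply/rclassP; rewrite rreprK. Qed.

Lemma rclass_is_zmod_morphism : zmod_morphism cl.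
Proof. exact: (raddfB (\pi_(Quotient.quot I))). Qed.
HB.instance Definition _ := GRing.isZmodMorphism.Build R Q cl
  rclass_is_zmod_morphism.

Definition rquot_one : Q := cl 1.
Definition rquot_mul (x y : Q) : Q := cl (rrepr x * rrepr y).

Lemma rclassM a b : cl (a * b) = rquot_mul (cl a) (cl b).
Proof.
apply/rclassP; rewrite -(subrK (rrepr (cl a) * b) (a * b)) -mulrBl -addrA.
rewrite -mulrBr; apply: rpredD; first exact: ideal2Mr (rrepr_class a).
exact: ideal2Ml (rrepr_class b).
Qed.

Fact rquot_mulA : associative rquot_mul.
Proof.
by move=> x y z; rewrite -[x]rreprK -[y]rreprK -[z]rreprK -!rclassM mulrA.
Qed.
Fact rquot_mul1 : left_id rquot_one rquot_mul.
Proof. by move=> x; rewrite -[x]rreprK -rclassM mul1r. Qed.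
Fact rquot_mulr1 : right_id rquot_one rquot_mul.
Proof. by move=> x; rewrite -[x]rreprK -rclassM mulr1. Qed.
Fact rquot_mulDl : left_distributive rquot_mul +%R.
Proof.
move=> x y z; rewrite -[x]rreprK -[y]rreprK -[z]rreprK.
by rewrite -raddfD -!rclassM mulrDl raddfD.
Qed.
Fact rquot_mulDr : right_distributive rquot_mul +%R.
Proof.
move=> x y z; rewrite -[x]rreprK -[y]rreprK -[z]rreprK.
by rewrite -raddfD -!rclassM mulrDr raddfD.
Qed.
HB.instance Definition _ := GRing.Zmodule_isPzRing.Build Q
  rquot_mulA rquot_mul1 rquot_mulr1 rquot_mulDl rquot_mulDr.

Fact rclass_is_monoid_morphism : monoid_morphism cl.
Proof. by split=> // a b; rewrite rclassM. Qed.
HB.instance Definition _ := GRing.isMonoidMorphism.Build R Q cl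
  rclass_is_monoid_morphism.
End RingQuotient.

Section ComRingQuotient.
Variables (R : comPzRingType) (I : ideal2 R).
Fact rquot_mulC : commutative (@GRing.mul (rquot I)).
Proof.
by move=> x y; rewrite -[x]rreprK -[y]rreprK -!rmorphM mulrC.
Qed.
HB.instance Definition _ :=
  GRing.PzRing_hasCommutativeMul.Build (rquot I) rquot_mulC.
End ComRingQuotient.

Section AlgQuotient.
Variables (R : pzRingType) (A : lalgType R) (I : ideal2 A).
Local Notation Q := (rquot I).
Local Notation cl := (rclass I).

Definition rquot_scale (r : R) (x : Q) : Q := cl (r *: rrepr x).

Lemma rclassZ r a : cl (r *: a) = rquot_scale r (cl a).
Proof.
apply/rclassP; rewrite -scalerBr -[_ - _]mul1r scalerAl.
by rewrite ideal2Ml ?rrepr_class.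
Qed.

Fact rquot_scaleA a b v : rquot_scale a (rquot_scale b v) = rquot_scale (a * b) v.
Proof. by rewrite -[v]rreprK -!rclassZ scalerA. Qed.
Fact rquot_scale1 : left_id 1 rquot_scale.
Proof. by move=> v; rewrite -[v]rreprK -!rclassZ scale1r. Qed.
Fact rquot_scaleDr : right_distributive rquot_scale +%R.
Proof.
move=> a u v; rewrite -[u]rreprK -[v]rreprK.
by rewrite -raddfD -!rclassZ scalerDr raddfD.
Qed.
Fact rquot_scaleDl v : {morph rquot_scale^~ v : a b / a + b}.
Proof. by move=> a b; rewrite -[v]rreprK -!rclassZ scalerDl raddfD. Qed.
HB.instance Definition _ := GRing.Zmodule_isLmodule.Build R Q
  rquot_scaleA rquot_scale1 rquot_scaleDr rquot_scaleDl.
End AlgQuotient.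

Section GeneratedIdeal.
Variables (R : pzRingType) (x : R).
Definition gen_ideal2 : pred R :=
  fun a => `[< exists s : seq (R * R), a = \sum_(p <- s) p.1 * x * p.2 >].

Fact gen_ideal2_zmod : zmod_closed gen_ideal2.
Proof.
split=> [|a b /asboolP [s ->] /asboolP [t ->]]; apply/asboolP.
  by exists [::]; rewrite big_nil.
exists (s ++ [seq (- p.1, p.2) | p <- t]); rewrite big_cat big_map /=.
by congr (_ + _); rewrite -sumrN; apply: eq_bigr => p _; rewrite !mulNr.
Qed.
HB.instance Definition _ := GRing.isZmodClosed.Build R gen_ideal2
  gen_ideal2_zmod.

Fact gen_ideal2Ml a b : b \in gen_ideal2 -> a * b \in gen_ideal2.
Proof.
move=> /asboolP [s ->]; apply/asboolP; exists [seq (a * p.1, p.2) | p <- s].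
by rewrite big_map mulr_sumr; apply: eq_bigr => p _; rewrite !mulrA.
Qed.
Fact gen_ideal2Mr a b : b \in gen_ideal2 -> b * a \in gen_ideal2.
Proof.
move=> /asboolP [s ->]; apply/asboolP; exists [seq (p.1, p.2 * a) | p <- s].
by rewrite big_map mulr_suml; apply: eq_bigr => p _; rewrite !mulrA.
Qed.
HB.instance Definition _ := isIdeal2.Build R gen_ideal2
  gen_ideal2Ml gen_ideal2Mr.
End GeneratedIdeal.

Definition lend (R : comPzRingType) (M : lmodType R) : Type := {linear M -> M}.

Section EndomorphismRing.
Variables (R : comPzRingType) (M : lmodType R).
Local Notation E := (lend M).

Definition lend_fun (f : E) : M -> M := GRing.Linear.sort f.
Coercion lend_fun : lend >-> Funclass.

HB.instance Definition _ := gen_eqMixin E.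
HB.instance Definition _ := gen_choiceMixin E.

Lemma lendP (f g : E) : f =1 g -> f = g.
Proof.
case: f => f [[fa] [fs]]; case: g => g [[ga] [gs]] /= /funext fg.
rewrite /lend_fun /= in fg; case: _ / fg in ga gs *.
by rewrite (Prop_irrelevance fa ga) (Prop_irrelevance fs gs).
Qed.

Lemma linear_lend (f : M -> M) : linear f -> {g : E | lend_fun g = f}.
Proof.
move=> fl; pose fL := GRing.isLinear.Build R M M *:%R f fl.
by exists (HB.pack_for {linear M -> M} f fL).
Qed.

Definition mk_lend (f : M -> M) (fl : linear f) : E := sval (linear_lend fl).

Lemma mk_lendE f fl x : @mk_lend f fl x = f x.
Proof. by rewrite /mk_lend; case: linear_lend => g /= ->. Qed.

Lemma lend_linear (f : E) : linear f.
Proof. by move=> a x y; rewrite /lend_fun linearP. Qed.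

Fact lend_zero_linear : linear (fun _ : M => 0 : M).
Proof. by move=> a x y; rewrite scaler0 addr0. Qed.
Fact lend_opp_linear (f : E) : linear (fun x => - f x).
Proof. by move=> a x y; rewrite lend_linear opprD scalerN. Qed.
Fact lend_add_linear (f g : E) : linear (fun x => f x + g x).
Proof. by move=> a x y; rewrite !lend_linear scalerDr addrACA. Qed.
Fact lend_one_linear : linear (fun x : M => x).
Proof. by []. Qed.
Fact lend_mul_linear (f g : E) : linear (fun x => f (g x)).
Proof. by move=> a x y; rewrite !lend_linear. Qed.
Fact lend_scale_linear (c : R) (f : E) : linear (fun x => c *: f x).
Proof. by move=> a x y; rewrite lend_linear scalerDr !scalerA mulrC. Qed.

Definition lend_zero := mk_lend lend_zero_linear.
Definition lend_opp f := mk_lend (lend_opp_linear f).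
Definition lend_add f g := mk_lend (lend_add_linear f g).
Definition lend_one := mk_lend lend_one_linear.
Definition lend_mul f g := mk_lend (lend_mul_linear f g).
Definition lend_scale c f := mk_lend (lend_scale_linear c f).

Fact lend_addA : associative lend_add.
Proof. by move=> f g h; apply: lendP => x; rewrite !mk_lendE addrA. Qed.
Fact lend_addC : commutative lend_add.
Proof. by move=> f g; apply: lendP => x; rewrite !mk_lendE addrC. Qed.
Fact lend_add0 : left_id lend_zero lend_add.
Proof. by move=> f; apply: lendP => x; rewrite !mk_lendE add0r. Qed.
Fact lend_addN : left_inverse lend_zero lend_opp lend_add.
Proof. by move=> f; apply: lendP => x; rewrite !mk_lendE addNr. Qed.
HB.instance Definition _ := GRing.isZmodule.Build E
  lend_addA lend_addC lend_add0 lend_addN.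

Fact lend_mulA : associative lend_mul.
Proof. by move=> f g h; apply: lendP => x; rewrite !mk_lendE. Qed.
Fact lend_mul1 : left_id lend_one lend_mul.
Proof. by move=> f; apply: lendP => x; rewrite !mk_lendE. Qed.
Fact lend_mulr1 : right_id lend_one lend_mul.
Proof. by move=> f; apply: lendP => x; rewrite !mk_lendE. Qed.
Fact lend_mulDl : left_distributive lend_mul +%R.
Proof. by move=> f g h; apply: lendP => x; rewrite !mk_lendE. Qed.
Fact lend_mulDr : right_distributive lend_mul +%R.
Proof.
move=> f g h; apply: lendP => x; rewrite !mk_lendE.
by have := lend_linear f 1 (g x) (h x); rewrite !scale1r.
Qed.
HB.instance Definition _ := GRing.Zmodule_isPzRing.Build E
  lend_mulA lend_mul1 lend_mulr1 lend_mulDl lend_mulDr.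

Fact lend_scaleA a b f : lend_scale a (lend_scale b f) = lend_scale (a * b) f.
Proof. by apply: lendP => x; rewrite !mk_lendE scalerA. Qed.
Fact lend_scale1 : left_id 1 lend_scale.
Proof. by move=> f; apply: lendP => x; rewrite !mk_lendE scale1r. Qed.
Fact lend_scaleDr : right_distributive lend_scale +%R.
Proof. by move=> a f g; apply: lendP => x; rewrite !mk_lendE scalerDr. Qed.
Fact lend_scaleDl f : {morph lend_scale^~ f : a b / a + b}.
Proof. by move=> a b; apply: lendP => x; rewrite !mk_lendE scalerDl. Qed.
HB.instance Definition _ := GRing.Zmodule_isLmodule.Build R E
  lend_scaleA lend_scale1 lend_scaleDr lend_scaleDl.

Lemma lend1E x : (1 : E) x = x. Proof. exact: mk_lendE. Qed.
Lemma lendME (f g : E) x : (f * g) x = f (g x). Proof. exact: mk_lendE. Qed.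
Lemma lendDE (f g : E) x : (f + g) x = f x + g x. Proof. exact: mk_lendE. Qed.
Lemma lendZE c (f : E) x : (c *: f) x = c *: f x. Proof. exact: mk_lendE. Qed.
End EndomorphismRing.

Definition finitely_generated (R : pzRingType) (M : lmodType R) : Prop :=
  exists (k : nat) (t : 'I_k -> M),
    forall m : M, exists c : 'I_k -> R, m = \sum_i c i *: t i.

Section LinearGroup.
Variables (K : fieldType) (V : vectType K).

Record linGroup := LinGroup {
  lin_elts :> {fset 'End(V)};
  lin_id : \1%VF \in lin_elts;
  lin_comp : forall f g, f \in lin_elts -> g \in lin_elts ->
    (f \o g)%VF \in lin_elts;
  lin_inv : forall f, f \in lin_elts -> exists2 g, g \in lin_elts &
    (g \o f)%VF = \1%VF /\ (f \o g)%VF = \1%VF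
}.

Definition elt (G : linGroup) : Type := fset_sub_type (lin_elts G).

Section GroupStructure.
Variable G : linGroup.
HB.instance Definition _ := SubFinite.on (elt G).

Definition elt_one : elt G := FSetSub (lin_id G).
Definition elt_mul (g h : elt G) : elt G :=
  FSetSub (lin_comp (fsvalP g) (fsvalP h)).
Fact elt_inv_subproof (g : elt G) : ((val g)^-1)%VF \in lin_elts G.
Proof.
have [h hG [hg gh]] := lin_inv (fsvalP g).
suff -> : ((val g)^-1)%VF = h by [].
have kg : lker (val g) == 0%VS.
  apply/lker0P => x y exy; have := congr1 (fun f : 'End(V) => f x) hg.
  have := congr1 (fun f : 'End(V) => f y) hg.
  by rewrite !comp_lfunE /= exy !id_lfunE => -> ->.
by rewrite -[LHS]comp_lfun1r -gh comp_lfunA lker0_compVf ?comp_lfun1l.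
Qed.
Definition elt_inv (g : elt G) : elt G := FSetSub (elt_inv_subproof g).

Fact elt_mulA : associative elt_mul.
Proof. by move=> f g h; apply: val_inj; rewrite /= comp_lfunA. Qed.
Fact elt_mul1 : left_id elt_one elt_mul.
Proof. by move=> g; apply: val_inj; rewrite /= comp_lfun1l. Qed.
Fact elt_mulV : left_inverse elt_one elt_inv elt_mul.
Proof.
move=> g; apply: val_inj => /=; have [h hG [hg gh]] := lin_inv (fsvalP g).
apply: lker0_compVf; apply/lker0P => x y exy.
have := congr1 (fun f : 'End(V) => f x) hg.
have := congr1 (fun f : 'End(V) => f y) hg.
by rewrite !comp_lfunE /= exy !id_lfunE => -> ->.
Qed.
HB.instance Definition _ := Finite_isGroup.Build (elt G)
  elt_mulA elt_mul1 elt_mulV.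
End GroupStructure.

Definition pseudo_reflection (g : 'End(V)) : Prop :=
  exists (zeta : K) (v : V) (b : seq V),
    [/\ basis_of {:V} (v :: b), zeta != 1,
        exists2 m, (0 < m)%N & zeta ^+ m = 1,
        g v = zeta *: v & {in b, forall w, g w = w}].

Definition reflections (G : linGroup) : {set elt G} :=
  [set s : elt G | `[< pseudo_reflection (val s) >]].

Definition mirror (g : 'End(V)) : {vspace V} := fixedSpace g.

Definition mirrors (G : linGroup) : seq {vspace V} :=
  undup [seq mirror (val s) | s <- enum (reflections G)].

Definition mirror_order (G : linGroup) (H : {vspace V}) : nat :=
  #|[set g : elt G | (H <= fixedSpace (val g))%VS]|.

Definition mirror_vectors (G : linGroup) (L : {vspace V} -> V) : Prop :=
  forall H, H \in mirrors G -> exists s : elt G,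
    [/\ s \in reflections G, mirror (val s) = H
      & <[L H]>%VS = limg (val s - \1%VF)].

(* Sym_K(V) as K[x_1, .., x_n], the x_i being the members of vbasis {:V}; sym1 is
   the inclusion of V as the linear forms. *)
Definition symV : Type := {mpoly K[\dim {:V}]}.
HB.instance Definition _ := GRing.IntegralDomain.on symV.
HB.instance Definition _ := GRing.Lmodule.on symV.

Definition sym1 (v : V) : symV := \sum_i coord (vbasis {:V}) i v *: ('X_i : symV).

Definition sym_act (g : 'End(V)) (f : symV) : symV :=
  f \mPo [tuple sym1 (g (tnth (vbasis {:V}) i)) | i < \dim {:V}].

Fact sym_act_is_zmod_morphism g : zmod_morphism (sym_act g).
Proof. by move=> f f'; rewrite /sym_act raddfB. Qed.
HB.instance Definition _ g := GRing.isZmodMorphism.Build symV symV (sym_act g)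
  (sym_act_is_zmod_morphism g).
Fact sym_act_is_monoid_morphism g : monoid_morphism (sym_act g).
Proof. by split=> [|f f']; rewrite /sym_act ?rmorph1 ?rmorphM. Qed.
HB.instance Definition _ g := GRing.isMonoidMorphism.Build symV symV (sym_act g)
  (sym_act_is_monoid_morphism g).

Lemma sym1_is_linear : linear sym1.
Proof.
move=> a u v; rewrite /sym1 scaler_sumr -big_split; apply: eq_bigr => i _ /=.
by rewrite linearP /= scalerDl scalerA.
Qed.
HB.instance Definition _ := GRing.isLinear.Build K V symV *:%R sym1
  sym1_is_linear.

Lemma sym_actZ g c f : sym_act g (c *: f) = c *: sym_act g f.
Proof. exact: comp_mpolyZ. Qed.

Lemma sym_act1 g v : sym_act g (sym1 v) = sym1 (g v).
Proof.
have -> : g v = \sum_i coord (vbasis {:V}) i v *: g (tnth (vbasis {:V}) i).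
  rewrite {1}(coord_vbasis (memvf v)) linear_sum.
  by apply: eq_bigr => i _; rewrite linearZ (tnth_nth 0).
rewrite [in RHS]linear_sum /sym1 raddf_sum; apply: eq_bigr => i _.
rewrite /= sym_actZ linearZ; congr (_ *: _).
by rewrite /sym_act comp_mpolyXU -tnth_nth tnth_mktuple.
Qed.

Lemma sym1_basis i : sym1 (tnth (vbasis {:V}) i) = 'X_i.
Proof.
rewrite /sym1 (bigD1 i) //= (tnth_nth 0) coord_free ?(basis_free (vbasisP _)) //.
rewrite eqxx scale1r big1 ?addr0 // => j /negPf ji.
by rewrite coord_free ?(basis_free (vbasisP _)) // eq_sym ji scale0r.
Qed.

Lemma sym_act_id f : sym_act \1%VF f = f.
Proof.
rewrite -[RHS]comp_mpoly_id /sym_act; congr (_ \mPo _).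
by apply: eq_from_tnth => i; rewrite !tnth_mktuple id_lfunE sym1_basis.
Qed.

Lemma sym_act_comp g h f : sym_act (g \o h)%VF f = sym_act g (sym_act h f).
Proof.
elim/mpolyind: f => [|c m p _ _ IH]; first by rewrite !raddf0.
rewrite !raddfD /= {}IH !sym_actZ; congr (_ *: _ + _).
rewrite /= mpolyXE_id !rmorph_prod; apply: eq_bigr => i _.
rewrite !rmorphXn /= -sym1_basis.
by rewrite !sym_act1 comp_lfunE.
Qed.

Definition invariant (G : linGroup) : pred symV :=
  fun f => [forall g : elt G, sym_act (val g) f == f].

Fact invariant_subring G : subring_closed (invariant G).
Proof.
split=> [|f f' /forallP h /forallP h'|f f' /forallP h /forallP h'];
  apply/forallP => g; rewrite ?rmorph1 ?rmorphB ?rmorphM //=.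
all: by rewrite (eqP (h g)) (eqP (h' g)).
Qed.
HB.instance Definition _ G := GRing.isSubringClosed.Build symV (invariant G)
  (invariant_subring G).

Record invRing (G : linGroup) : Type :=
  InvRing { inv_val :> symV; inv_valP : inv_val \in invariant G }.

Section Invariants.
Variable G : linGroup.
HB.instance Definition _ := [isSub for @inv_val G].
HB.instance Definition _ := [Choice of invRing G by <:].
HB.instance Definition _ :=
  [SubChoice_isSubComNzRing of invRing G by <:].

Lemma sym_act_inv (g : elt G) (r : invRing G) :
  sym_act (val g) (val r) = val r.
Proof. by case: r => r /= /forallP /(_ g)/eqP. Qed.
End Invariants.

Definition discriminant (G : linGroup) (L : {vspace V} -> V) : symV :=
  \prod_(H <- mirrors G) sym1 (L H) ^+ mirror_order G H.

(* The ideal of S^G generated by a polynomial D, as the S^G-multiples of D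
   that lie in S^G; this is the principal ideal (D) when D is invariant. *)
Section PrincipalIdeal.
Variables (G : linGroup) (D : symV).
Definition inv_ideal : pred (invRing G) :=
  fun r => `[< exists q : invRing G, val r = val q * D >].

Fact inv_ideal_zmod : zmod_closed inv_ideal.
Proof.
split=> [|a b /asboolP [s es] /asboolP [t et]]; apply/asboolP.
  by exists 0; rewrite !raddf0 mul0r.
by exists (s - t); rewrite !raddfB /= mulrBl es et.
Qed.
HB.instance Definition _ := GRing.isZmodClosed.Build (invRing G) inv_ideal
  inv_ideal_zmod.
Fact inv_idealMl a b : b \in inv_ideal -> a * b \in inv_ideal.
Proof.
move=> /asboolP [q eq]; apply/asboolP; exists (a * q).
by rewrite !rmorphM /= eq mulrA.
Qed.
Fact inv_idealMr a b : b \in inv_ideal -> b * a \in inv_ideal.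
Proof. by rewrite mulrC; apply: inv_idealMl. Qed.
HB.instance Definition _ := isIdeal2.Build (invRing G) inv_ideal
  inv_idealMl inv_idealMr.
End PrincipalIdeal.

Definition disc_ring (G : linGroup) (L : {vspace V} -> V) : Type :=
  rquot (Ideal2.clone (invRing G) (@inv_ideal G (discriminant G L)) _).
HB.instance Definition _ G L := GRing.ComPzRing.on (disc_ring G L).

Definition disc_class (G : linGroup) (L : {vspace V} -> V) (r : invRing G) :
  disc_ring G L := rclass (Ideal2.clone (invRing G) (@inv_ideal G (discriminant G L)) _) r.

(* The function a stands for \sum_g a(g) delta_g. *)
Definition skew (G : linGroup) : Type := {ffun elt G -> symV}.

Section SkewGroupAlgebra.
Variable G : linGroup.
Local Notation A := (skew G).
HB.instance Definition _ := GRing.Zmodule.on A.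

Definition delta (s : symV) (g : elt G) : A :=
  [ffun k => if k == g then s else 0].

Definition skew_one : A := delta 1 1%g.
Definition skew_mul (a b : A) : A :=
  [ffun k => \sum_(h : elt G) a h * sym_act (val h) (b (h^-1 * k)%g)].
Definition skew_scale (r : invRing G) (a : A) : A := [ffun k => val r * a k].

Fact skew_mulA : associative skew_mul.
Proof.
move=> a b c; apply/ffunP => k; rewrite !ffunE.
transitivity (\sum_(h : elt G) \sum_(l : elt G)
   a h * sym_act (val h) (b (h^-1 * l)%g) * sym_act (val l) (c (l^-1 * k)%g)).
  apply: eq_bigr => h _; rewrite ffunE rmorph_sum mulr_sumr.
  rewrite (reindex_inj (mulgI h^-1%g)); apply: eq_bigr => l _ /=.
  rewrite rmorphM mulrA /= -sym_act_comp; congr (_ * sym_act _ (c _)).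
    by rewrite -[LHS]/(val (h * (h^-1 * l))%g) mulKVg.
  by rewrite invMg invgK -mulgA mulKVg.
rewrite exchange_big; apply: eq_bigr => l _ /=.
by rewrite ffunE mulr_suml.
Qed.
Fact skew_mul1 : left_id skew_one skew_mul.
Proof.
move=> a; apply/ffunP => k; rewrite !ffunE (bigD1 1%g) //= !ffunE eqxx.
rewrite sym_act_id mul1r invg1 mul1g big1 ?addr0 // => h /negPf h1.
by rewrite ffunE h1 mul0r.
Qed.
Fact skew_mulr1 : right_id skew_one skew_mul.
Proof.
move=> a; apply/ffunP => k; rewrite !ffunE (bigD1 k) //= !ffunE.
rewrite mulVg eqxx rmorph1 mulr1 big1 ?addr0 // => h hk.
by rewrite ffunE -eq_mulVg1 (negPf hk) raddf0 mulr0.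
Qed.
Fact skew_mulDl : left_distributive skew_mul +%R.
Proof.
move=> a b c; apply/ffunP => k; rewrite !ffunE -big_split /=.
by apply: eq_bigr => h _; rewrite ffunE mulrDl.
Qed.
Fact skew_mulDr : right_distributive skew_mul +%R.
Proof.
move=> a b c; apply/ffunP => k; rewrite !ffunE -big_split /=.
by apply: eq_bigr => h _; rewrite ffunE raddfD mulrDr.
Qed.
Fact skew_one_neq0 : skew_one != 0.
Proof.
apply/eqP => /ffunP /(_ 1%g); rewrite !ffunE eqxx.
by move/eqP; rewrite oner_eq0.
Qed.
HB.instance Definition _ := GRing.Zmodule_isNzRing.Build A
  skew_mulA skew_mul1 skew_mulr1 skew_mulDl skew_mulDr skew_one_neq0.

Lemma deltaM (s' s : symV) (g' g : elt G) :
  delta s' g' * delta s g = delta (s' * sym_act (val g') s) (g' * g)%g.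
Proof.
apply/ffunP => k; rewrite !ffunE (bigD1 g') //= !ffunE eqxx.
rewrite big1 ?addr0 => [|h /negPf hg]; last by rewrite ffunE hg mul0r.
rewrite -(inj_eq (mulgI g')) mulKVg.
by case: eqP => // _; rewrite raddf0 mulr0.
Qed.

Fact skew_scaleA a b v : skew_scale a (skew_scale b v) = skew_scale (a * b) v.
Proof. by apply/ffunP => k; rewrite !ffunE mulrA. Qed.
Fact skew_scale1 : left_id 1 skew_scale.
Proof. by move=> v; apply/ffunP => k; rewrite !ffunE mul1r. Qed.
Fact skew_scaleDr : right_distributive skew_scale +%R.
Proof. by move=> a u v; apply/ffunP => k; rewrite !ffunE mulrDr. Qed.
Fact skew_scaleDl v : {morph skew_scale^~ v : a b / a + b}.
Proof. by move=> a b; apply/ffunP => k; rewrite !ffunE raddfD /= mulrDl. Qed.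
HB.instance Definition _ := GRing.Zmodule_isLmodule.Build (invRing G) A
  skew_scaleA skew_scale1 skew_scaleDr skew_scaleDl.

Fact skew_scaleAl (r : invRing G) (a b : A) : r *: (a * b) = r *: a * b.
Proof.
apply/ffunP => k; rewrite !ffunE mulr_sumr; apply: eq_bigr => h _.
by rewrite ffunE mulrA.
Qed.
HB.instance Definition _ := GRing.Lmodule_isLalgebra.Build (invRing G) A
  skew_scaleAl.
Fact skew_scaleAr (r : invRing G) (a b : A) : r *: (a * b) = a * (r *: b).
Proof.
apply/ffunP => k; rewrite !ffunE mulr_sumr; apply: eq_bigr => h _.
by rewrite ffunE rmorphM /= sym_act_inv mulrCA.
Qed.
HB.instance Definition _ := GRing.Lalgebra_isAlgebra.Build (invRing G) A
  skew_scaleAr.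

Definition skew_e : A :=
  \sum_(g : elt G) delta (((#|[set: elt G]|%:R : K)^-1)%:MP) g.

Definition Abar : Type := rquot (Ideal2.clone A (gen_ideal2 skew_e) _).
HB.instance Definition _ := GRing.PzRing.on Abar.
HB.instance Definition _ := GRing.Lmodule.on Abar.
End SkewGroupAlgebra.

(* Isomorphism of S^G/(Delta)-algebras.  Since Delta annihilates Abar, the class
   of r in S^G/(Delta) acts on Abar as r itself does, so linearity over
   S^G/(Delta) is linearity over S^G along the projection disc_class. *)
Definition disc_alg_iso (G : linGroup) (L : {vspace V} -> V)
    (M : lmodType (disc_ring G L)) : Prop :=
  exists phi : {rmorphism Abar G -> lend M},
    bijective phi /\
    forall (r : invRing G) (x : Abar G), phi (r *: x) = disc_class L r *: phi x.
End LinearGroup.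

(* Main.v *)
Require Import Defs.
From HB Require Import structures.
From mathcomp Require Import all_boot all_order all_fingroup all_algebra finmap.
From mathcomp Require Import cyclic mpoly.
From mathcomp Require Import complex boolp reals ring.

(* Let [s] be a reflection of order at least 3, [x] a linear form spanning the
   image of [s - 1], and [p] the prime ideal of [R] under [xS].  Localised at
   [p], the ring [R/(Delta)] is a field, so the endomorphism ring of a finitely
   generated module becomes a matrix ring, hence simple: every two-sided ideal
   of it is [p]-torsion or contains a scalar outside [p].  On the other hand let
   [I] be the radical ideal of the union of the [G]-orbit of the hyperplane
   [x = 0].  The [S*G]-modules [I/I^(2)] and [I^(2)/I^(3)] are killed by [e],
   since [s] acts on them generically by [lam] and [lam^2], both different from
   1; they are torsion-free over [R/p], and because [lam != lam^2] they are not
   isomorphic: some element of [S*G] kills the first but not the second.  The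
   ideal it generates in [A/AeA] is not torsion, yet meets [R] only in [p].

   That [p] becomes zero in [A/AeA] after localisation follows, without the
   discriminant, from the elements [\prod_(h != 1) (h b_h - b_h)] of
   [AeA] in [S], which for suitable [b_h] are [x^(|W| - 1)] times a polynomial
   prime to [x], where [W] is the inertia group of [x]. *)

Set Implicit Arguments.
Unset Strict Implicit.
Unset Printing Implicit Defensive.

Import GRing.Theory.
Local Open Scope ring_scope.

(* MathComp also has a [skew] notation, for sesquilinear forms. *)
Local Notation skew := Defs.skew.

(** * Pointwise evaluation in endomorphism rings *)

Section LendFun.
Variables (C : comPzRingType) (M : lmodType C).
Implicit Types f g : lend M.

Lemma lend_fun0 x : lend_fun (0 : lend M) x = 0. Proof. exact: mk_lendE. Qed.
Lemma lend_fun1 x : lend_fun (1 : lend M) x = x. Proof. exact: mk_lendE. Qed.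
Lemma lend_funD f g x : lend_fun (f + g) x = lend_fun f x + lend_fun g x.
Proof. exact: mk_lendE. Qed.
Lemma lend_funM f g x : lend_fun (f * g) x = lend_fun f (lend_fun g x).
Proof. exact: mk_lendE. Qed.
Lemma lend_funZ c f x : lend_fun (c *: f) x = c *: lend_fun f x.
Proof. exact: mk_lendE. Qed.
End LendFun.

(** * Endomorphism rings are generically matrix algebras *)

Section GenericMatrixAlgebra.
Variables (C : comPzRingType) (M : lmodType C) (q : C).

(** In the application this is p, with [q] outside p and [q] p zero in A/AeA. The factor [q] does
    the work of localising at p. *)
Definition ann (c : C) : Prop := forall m : M, (q * c) *: m = 0.

Hypothesis ann_prime : forall a b, ann (a * b) -> ann a \/ ann b.
Hypothesis q_nann : ~ ann q.

Lemma ann1 : ~ ann 1.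
Proof.
move=> h; apply: q_nann => m.
by rewrite -scalerA; have := h (q *: m); rewrite mulr1.
Qed.

Lemma ann_prod (I : finType) (F : I -> C) :
  ann (\prod_i F i) -> exists i, ann (F i).
Proof.
apply: contraPP => /forallNP nF.
by elim/big_ind: _ => [|a b na nb /ann_prime [] //|i _]; [exact: ann1|exact: nF].
Qed.

Definition ann_free (k : nat) (t : 'I_k -> M) (I : {set 'I_k}) : Prop :=
  forall c : 'I_k -> C, \sum_(i in I) c i *: t i = 0 -> forall i, i \in I -> ann (c i).

(** A maximal free subfamily of the generators serves as basis: each generator has a multiple in its
    span, and the product of these denominators is [e]. *)
Lemma ann_basis : finitely_generated M ->
  exists (k : nat) (t : 'I_k -> M) (I : {set 'I_k}) (e : C),
  [/\ ~ ann e, ann_free t I &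
   forall m, exists c : 'I_k -> C, e *: m = \sum_(i in I) c i *: t i].
Proof.
case=> k [t gen].
have free0 : `[< ann_free t set0 >] by apply/asboolP => c _ i; rewrite inE.
have [I /maxsetP [/asboolP Ifree Imax] _] :=
  @maxset_exists _ (fun I => `[< ann_free t I >]) _ free0.
have /choice [d dP] : forall j, exists d : C, ~ ann d /\
    exists c : 'I_k -> C, d *: t j = \sum_(i in I) c i *: t i.
  move=> j; have [jI|jI] := boolP (j \in I).
    exists 1; split; first exact: ann1.
    exists (fun i => (i == j)%:R); rewrite (bigD1 j) //= eqxx big1 ?addr0 //.
    by move=> i /andP [_ /negPf ->]; rewrite scale0r.
  have : ~ ann_free t (j |: I).
    move=> /asboolP /Imax /(_ (subsetUr _ _)) e.
    by rewrite -e setU11 in jI.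
  move=> /existsNP [c /not_implyP [c0 /existsNP [i /not_implyP [iI ci]]]].
  rewrite big_setU1 //= in c0.
  (* If [c j] is in [ann], multiplying by [q] removes the [j]-th term, and freeness over [I] puts
     the other coefficients in [ann] too. *)
  have [cj|cj] := pselect (ann (c j)).
    case: (ci); have : \sum_(i in I) (q * c i) *: t i = 0.
      move/(congr1 ( *:%R q)): c0; rewrite scaler0 scalerDr scalerA cj add0r.
      by rewrite scaler_sumr; under eq_bigr do rewrite scalerA.
    move/Ifree => /(_ i).
    move: iI; rewrite in_setU1 => /orP [/eqP -> //|iI] /(_ iI) /ann_prime.
    by case.
  exists (c j); split=> //; exists (fun i => - c i).
  move/eqP: c0; rewrite addr_eq0 => /eqP ->; rewrite -sumrN.
  by apply: eq_bigr => l _; rewrite scaleNr.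
exists k, t, I, (\prod_j d j); split=> //.
  by move/ann_prod => [j]; case: (dP j).
move=> m; have [b ->] := gen m.
have /choice [c cP] : forall j, exists c : 'I_k -> C,
    (\prod_j d j) *: t j = \sum_(i in I) c i *: t i.
  move=> j; have [_ [c cP]] := dP j.
  exists (fun i => \prod_(l | l != j) d l * c i).
  rewrite (bigD1 j) //= mulrC -scalerA cP scaler_sumr.
  by apply: eq_bigr => l _; rewrite scalerA.
exists (fun i => \sum_j b j * c j i).
rewrite scaler_sumr.
under [LHS]eq_bigr => j _ do rewrite scalerA mulrC -scalerA cP scaler_sumr.
rewrite exchange_big; apply: eq_bigr => i _ /=; rewrite scaler_suml.
by apply: eq_bigr => j _; rewrite scalerA.
Qed.

(* Up to elements outside the prime [ann], the ring [lend M] is a matrix ring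
   over a field: a two-sided ideal is torsion or contains a nonzero scalar. *)
Lemma lend_generically_simple (z : lend M) : finitely_generated M ->
  (exists2 e, ~ ann e & e *: z = 0) \/
  (exists2 e, ~ ann e & exists s : seq (lend M * lend M),
      e *: (1 : lend M) = \sum_(x <- s) x.1 * z * x.2).
Proof.
move=> /ann_basis [k [t [I [e [ne Ifree basis]]]]].
have /choice [c cP] : forall m, exists c : 'I_k -> C,
    e *: m = \sum_(i in I) c i *: t i /\ forall i, i \notin I -> c i = 0.
  move=> m; have [c ->] := basis m.
  exists (fun i => if i \in I then c i else 0); split; last by move=> i /negPf ->.
  by apply: eq_bigr => i ->.
(* Coordinates are unique up to [ann] only; multiplication by [q] repairs this. *)
have lin (i l : 'I_k) : linear (fun m => (q * c m i) *: t l).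
  move=> a m m'; apply/eqP; rewrite -subr_eq0 scalerA -scalerDl -scalerBl.
  rewrite mulrCA -mulrDr -mulrBr; apply/eqP.
  have [iI|iI] := boolP (i \in I); last first.
    by rewrite !(proj2 (cP _)) // mulr0 addr0 subrr mulr0 scale0r.
  apply: (Ifree (fun i => c (a *: m + m') i - (a * c m i + c m' i))) => //.
  under eq_bigr do rewrite scalerBl scalerDl -scalerA.
  rewrite sumrB big_split -scaler_sumr /= -!(proj1 (cP _)).
  by rewrite scalerDr !scalerA [e * a]mulrC subrr.
have [zero|] :=
    pselect (forall i l, i \in I -> l \in I -> ann (c (lend_fun z (t l)) i)).
  (* One [e] expands [m], the other expands each [z (t l)]; [q] kills the matrix entries, all of
     which lie in [ann]. *)
  left; exists (q * (e * e)); first by do 2![case/ann_prime => //].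
  apply: lendP => m; rewrite lend_funZ lend_fun0 mulrA -scalerA.
  have zZ a u : a *: lend_fun z u = lend_fun z (a *: u) by rewrite /lend_fun linearZ.
  rewrite zZ (proj1 (cP m)) /lend_fun linear_sum scaler_sumr big1 // => l lI.
  rewrite linearZ scalerA mulrC -!scalerA (proj1 (cP _)).
  rewrite scaler_sumr big1 ?scaler0 // => i iI.
  by rewrite scalerA zero.
move=> /existsNP [i /existsNP [l /not_implyP [iI /not_implyP [lI nil_]]]].
(* For [i] in [I] this is [q * e] times the matrix unit carrying [t i] to [t l]. Such units move the
   entry of [z] outside [ann] to every diagonal place. *)
pose th i l : lend M := mk_lend (lin i l).
right; exists (q * (q * (c (lend_fun z (t l)) i * e))).
  by do 3![case/ann_prime => //].
exists [seq (th i j, th j l) | j <- enum I]; apply: lendP => m.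
have sumE (F : 'I_k -> lend M) :
    lend_fun (\sum_(j in I) F j) m = \sum_(j in I) lend_fun (F j) m.
  by apply: (big_morph (fun f => lend_fun f m)) => [f g|];
    rewrite ?lend_funD ?lend_fun0.
rewrite big_map big_enum /= sumE lend_funZ lend_fun1 !mulrA -scalerA (proj1 (cP m)).
rewrite scaler_sumr; apply: eq_bigr => j jI; rewrite !lend_funM mk_lendE.
have -> : lend_fun (th j l) m = (q * c m j) *: t l by rewrite mk_lendE.
have -> : lend_fun z ((q * c m j) *: t l) = (q * c m j) *: lend_fun z (t l).
  by rewrite /lend_fun linearZ.
have : lend_fun (th i j) ((q * c m j) *: lend_fun z (t l)) =
    (q * c m j) *: lend_fun (th i j) (lend_fun z (t l)) by rewrite /lend_fun linearZ.
rewrite !mk_lendE => ->; rewrite !scalerA; congr (_ *: _); ring.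
Qed.
End GenericMatrixAlgebra.

(** * Divisibility by a linear form *)

Section Transvections.
Variables (K : fieldType) (V : vectType K) (v : V).
Local Notation x := (sym1 v).

Definition trivial_mod (g : 'End(V)) : Prop := forall b, g b - b \in <[v]>%VS.

Definition xdvd (i : nat) (f : symV V) : Prop := exists h, f = h * x ^+ i.

Lemma xdvd0 f : xdvd 0 f. Proof. by exists f; rewrite mulr1. Qed.

Lemma xdvd_zero i : xdvd i 0. Proof. by exists 0; rewrite mul0r. Qed.

Lemma xdvdD i f g : xdvd i f -> xdvd i g -> xdvd i (f + g).
Proof. by case=> a -> [b ->]; exists (a + b); rewrite mulrDl. Qed.

Lemma xdvdMl i f g : xdvd i g -> xdvd i (f * g).
Proof. by case=> a ->; exists (f * a); rewrite mulrA. Qed.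

Lemma xdvdMr i f g : xdvd i f -> xdvd i (f * g).
Proof. by rewrite mulrC; apply: xdvdMl. Qed.

Lemma xdvdN i f : xdvd i f -> xdvd i (- f).
Proof. by rewrite -mulN1r; apply: xdvdMl. Qed.

Lemma xdvdM i j f g : xdvd i f -> xdvd j g -> xdvd (i + j) (f * g).
Proof. by case=> a -> [b ->]; exists (a * b); rewrite exprD mulrACA. Qed.

Lemma xdvdW i f : xdvd i.+1 f -> xdvd i f.
Proof. by case=> a ->; exists (a * x); rewrite exprS mulrA. Qed.

Lemma xdvd_sum i (I : finType) (P : pred I) (F : I -> symV V) :
  (forall j, P j -> xdvd i (F j)) -> xdvd i (\sum_(j | P j) F j).
Proof. by move=> FP; elim/big_ind: _ => //; [exact: xdvd_zero|exact: xdvdD]. Qed.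

Lemma sym1_inj : injective (@sym1 K V).
Proof.
move=> a b /eqP; rewrite -subr_eq0 -linearB /= => /eqP ab0; apply/eqP.
rewrite -subr_eq0; apply/eqP; set w := a - b in ab0 *.
rewrite (coord_vbasis (memvf w)) big1 // => i _.
move/(congr1 (mcoeff U_(i))): ab0.
rewrite mcoeff0 /sym1 linear_sum /= (bigD1 i) //= mcoeffZ mcoeffXU eqxx mulr1.
rewrite big1 ?addr0 => [->|j /negPf ji]; first by rewrite scale0r.
by rewrite mcoeffZ mcoeffXU ji mulr0.
Qed.

Lemma sym1_eq0 w : (sym1 w == 0 :> symV V) = (w == 0).
Proof. by rewrite -(inj_eq (@sym1_inj) w) linear0. Qed.

(** The polynomials fixed modulo x contain the variables and are closed under products, as g(ab) -
    ab = g(a)(g(b) - b) + (g(a) - a)b. *)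
Lemma sym_act_trivial_mod g : trivial_mod g ->
  forall f, xdvd 1 (sym_act g f - f).
Proof.
move=> gv.
have gM a b : xdvd 1 (sym_act g a - a) -> xdvd 1 (sym_act g b - b) ->
    xdvd 1 (sym_act g (a * b) - a * b).
  move=> ha hb; rewrite rmorphM /=.
  have -> : sym_act g a * sym_act g b - a * b =
    sym_act g a * (sym_act g b - b) + (sym_act g a - a) * b.
    by rewrite mulrBr mulrBl addrA subrK.
  by apply: xdvdD; [exact: xdvdMl|exact: xdvdMr].
have g1 : xdvd 1 (sym_act g 1 - 1) by rewrite rmorph1 subrr; apply: xdvd_zero.
elim/mpolyind => [|c m p _ _ IH]; first by rewrite raddf0 subr0; apply: xdvd_zero.
rewrite raddfD /= opprD addrACA; apply: xdvdD => //.
rewrite sym_actZ -scalerBr -mul_mpolyC; apply: xdvdMl.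
rewrite mpolyXE_id; elim/big_ind: _ => // i _.
elim: (m i) => [|n IHn]; first by rewrite expr0.
rewrite exprS; apply: gM => //; rewrite -sym1_basis sym_act1 -linearB /=.
by have /vlineP [k ->] := gv (tnth (vbasis {:V}) i); exists (k%:MP);
  rewrite expr1 linearZ mul_mpolyC.
Qed.
End Transvections.

(** * Reduction modulo the linear form of a reflection *)

Section Reflection.
Variables (K : fieldType) (V : vectType K) (v : V) (s : 'End(V)) (lam : K).
Hypotheses (v0 : v != 0) (sv : s v = lam *: v) (lam1 : lam != 1).
Hypothesis smod : trivial_mod v s.
Local Notation x := (sym1 v).
Local Notation xdvd := (xdvd v).

(** Since [s - lam] kills [v] and is multiplication by [1 - lam] on the mirror, this is the
    projection onto the mirror along [v]. *)
Definition mirror_proj : 'End(V) := ((1 - lam)^-1 *: (s - lam *: \1))%VF.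

(* Restriction of a polynomial to the mirror: reduction modulo [x]. *)
Local Notation ev := (sym_act mirror_proj).

Lemma mirror_projE w : mirror_proj w = (1 - lam)^-1 *: (s w - lam *: w).
Proof.
by rewrite /mirror_proj scale_lfunE add_lfunE opp_lfunE scale_lfunE id_lfunE.
Qed.

Lemma mirror_proj_v : mirror_proj v = 0.
Proof. by rewrite mirror_projE sv subrr scaler0. Qed.

Let lam1' : 1 - lam != 0. Proof. by rewrite subr_eq0 eq_sym. Qed.

Lemma mirror_proj_mod : trivial_mod v mirror_proj.
Proof.
move=> w; rewrite mirror_projE -{3}[w](scalerK lam1') -scalerBr scalerBl scale1r.
by rewrite opprB addrA subrK memvZ.
Qed.

Lemma mirror_proj_eq0 w : mirror_proj w = 0 -> w \in <[v]>%VS.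
Proof. by move=> pw; have := mirror_proj_mod w; rewrite pw sub0r memvN. Qed.

Lemma ev_sym1 w : ev (sym1 w) = sym1 (mirror_proj w).
Proof. exact: sym_act1. Qed.

Lemma ev_x : ev x = 0. Proof. by rewrite ev_sym1 mirror_proj_v linear0. Qed.

Lemma x_neq0 : x != 0. Proof. by rewrite sym1_eq0. Qed.

Lemma evP f : ev f = 0 <-> xdvd 1 f.
Proof.
split=> [f0|[h ->]]; last by rewrite rmorphM /= expr1 ev_x mulr0.
have := sym_act_trivial_mod mirror_proj_mod f.
by rewrite f0 sub0r => /xdvdN; rewrite opprK.
Qed.

Lemma xdvdS_expl i h : xdvd i.+1 (h * x ^+ i) <-> ev h = 0.
Proof.
rewrite evP; split=> [[k]|[k ->]]; last by exists k; rewrite -mulrA expr1 -exprS.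
rewrite exprS mulrA => /(mulIf (expf_neq0 _ x_neq0)) ->.
by exists k.
Qed.

Lemma xdvd_cancel i r f : ev r <> 0 -> xdvd i (r * f) -> xdvd i f.
Proof.
move=> r0; elim: i => [|i IH] rf; first exact: xdvd0.
have [h fE] := IH (xdvdW rf); rewrite fE; apply/xdvdS_expl.
move: rf; rewrite fE mulrA => /xdvdS_expl /eqP.
by rewrite rmorphM /= mulf_eq0 => /orP [] /eqP.
Qed.

Lemma ev_act g f : trivial_mod v g -> ev (sym_act g f) = ev f.
Proof.
by move=> /sym_act_trivial_mod /(_ f) /evP /eqP; rewrite rmorphB /= subr_eq0 => /eqP.
Qed.

Lemma sym_act_xX (g : 'End(V)) c i h : g v = c *: v ->
  sym_act g (h * x ^+ i) = (c ^+ i)%:MP * sym_act g h * x ^+ i.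
Proof.
move=> gv; rewrite rmorphM rmorphXn /= sym_act1 gv linearZ /= exprZn.
by rewrite -mul_mpolyC mulrCA mulrA.
Qed.

(** Write f = h x^i. As [g] fixes h modulo x, invariance of [f] gives (c^i - 1) h = 0 modulo x. *)
Lemma xdvd_jump (g : 'End(V)) c i f : trivial_mod v g -> g v = c *: v -> c ^+ i != 1 ->
  sym_act g f = f -> xdvd i f -> xdvd i.+1 f.
Proof.
move=> gmod gv ci gf [h fE]; rewrite fE; apply/xdvdS_expl.
move: gf; rewrite fE (sym_act_xX _ _ gv) => /(mulIf (expf_neq0 _ x_neq0)).
move/(congr1 ev)/eqP; rewrite rmorphM /= ev_act // [sym_act _ _%:MP]comp_mpolyC.
rewrite -subr_eq0 -[X in _ - X]mul1r -mulrBl mulf_eq0 -mpolyC1 -mpolyCB.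
by rewrite mpolyC_eq0 subr_eq0 (negPf ci) => /eqP.
Qed.
End Reflection.

(** * The inertia group of a linear form *)

Section Inertia.
Variables (K : fieldType) (V : vectType K) (G : linGroup V) (v : V).
Hypotheses (char0 : forall n, n.+1%:R != 0 :> K) (v0 : v != 0).

Definition inertia : {set elt G} := [set g : elt G | `[< trivial_mod v (val g) >]].

Lemma inertiaP (g : elt G) : reflect (trivial_mod v (val g)) (g \in inertia).
Proof. by rewrite inE; apply: asboolP. Qed.

Lemma elt1E w : val (1%g : elt G) w = w. Proof. exact: id_lfunE. Qed.

Lemma eltME (g h : elt G) w : val (g * h)%g w = val g (val h w).
Proof. exact: comp_lfunE. Qed.

Lemma eltK (g : elt G) w : val (g^-1)%g (val g w) = w.
Proof. by rewrite -eltME mulVg elt1E. Qed.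

(* A transvection of finite order is trivial in characteristic [0]. *)
Lemma inertia_faithful (g : elt G) : g \in inertia -> val g v = v -> g = 1%g.
Proof.
move=> /inertiaP gmod gv; apply: val_inj; apply/lfunP => b; rewrite elt1E.
have gX n : val (g ^+ n)%g b = b + n%:R *: (val g b - b).
  elim: n => [|n IH]; first by rewrite expg0 elt1E scale0r addr0.
  have /vlineP [k kE] := gmod b.
  rewrite expgS eltME IH kE linearD linearZ linearZ /= gv -[val g b](subrK b) kE.
  by rewrite -addn1 natrD scalerDl scale1r -addrA addrCA [X in _ + X]addrC.
have := gX #[g]%g; rewrite expg_order elt1E => /(congr1 (fun z => z - b)).
rewrite subrr addrAC subrr add0r => /esym/eqP; rewrite scaler_eq0.
by rewrite -[#[g]%g]prednK ?order_gt0 // (negPf (char0 _)) subr_eq0 => /eqP.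
Qed.

Lemma inertia_eigen (g : elt G) : g \in inertia -> exists c, val g v = c *: v.
Proof.
move=> /inertiaP /(_ v) /vlineP [k kE]; exists (k + 1).
by rewrite scalerDl scale1r -kE subrK.
Qed.

(** The eigenvalue on [v] is injective on the inertia group, by [inertia_faithful], while at most
    [m] scalars satisfy c^m = 1. *)
Lemma inertia_exists_neq1 m : (0 < m < #|inertia|)%N ->
  exists2 g, g \in inertia & exists2 c, val g v = c *: v & c ^+ m != 1.
Proof.
case/andP=> m0 mW; apply: contrapT => none.
have /choice [chi chiP] : forall g : elt G, exists c, g \in inertia -> val g v = c *: v.
  move=> g; have [/inertia_eigen [c cE]|_] := boolP (g \in inertia).
    by exists c.
  by exists 0.
have chi_inj : {in inertia &, injective chi}.
  move=> g h gI hI gh; apply/eqP; rewrite eq_mulVg1; apply/eqP.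
  apply: inertia_faithful; last by rewrite eltME chiP // -gh -chiP // eltK.
  apply/inertiaP => b; rewrite eltME.
  have -> : val (g^-1)%g (val h b) - b = val (g^-1)%g (val h b - val g b).
    by rewrite linearB /= eltK.
  have /vlineP [k kE] : val h b - val g b \in <[v]>%VS.
    have -> : val h b - val g b = (val h b - b) - (val g b - b).
      by rewrite opprB addrA subrK.
    by apply: memvB; [apply/inertiaP: b|apply/inertiaP: b].
  rewrite kE linearZ /= memvZ //.
  have /eqP cg := chiP g gI; have : chi g != 0.
    apply: contraNneq v0 => c0; move: cg; rewrite c0 scale0r => /eqP gv0.
    by rewrite -[v](eltK g) gv0 linear0.
  move=> c0; have vE : v = (chi g)^-1 *: val g v by rewrite chiP ?scalerK.
  rewrite {1}vE linearZ /= eltK.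
  by rewrite memvZ ?memv_line.
suff : (size [seq chi g | g <- enum inertia] <= m)%N.
  by rewrite size_map -cardE leqNgt mW.
apply: max_unity_roots => //; last first.
  rewrite map_inj_in_uniq ?enum_uniq // => g h; rewrite !mem_enum.
  exact: chi_inj.
apply/allP => _ /mapP [g gI ->]; apply/unity_rootP; rewrite mem_enum in gI.
apply/eqP/negPn/negP => cm; apply: none; exists g => //.
by exists (chi g) => //; apply: chiP.
Qed.
End Inertia.

(** * Polynomials in the ideal AeA *)

Section IdempotentIdeal.
Variables (K : fieldType) (V : vectType K) (G : linGroup V).
Hypothesis char0 : forall n, n.+1%:R != 0 :> K.
Local Notation AeA := (gen_ideal2 (skew_e G)).

Lemma skew_mulE (a b : skew G) k :
  (a * b) k = \sum_(h : elt G) a h * sym_act (val h) (b (h^-1 * k)%g).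
Proof. by rewrite ffunE. Qed.

Lemma delta1M f (a : skew G) : delta f 1%g * a = [ffun g => f * a g].
Proof.
apply/ffunP => k; rewrite skew_mulE (bigD1 1%g) //= !ffunE eqxx invg1 mul1g.
by rewrite sym_act_id big1 ?addr0 // => h /negPf h1; rewrite ffunE h1 mul0r.
Qed.

Lemma mul_delta1 b (a : skew G) :
  a * delta b 1%g = [ffun g => a g * sym_act (val g) b].
Proof.
apply/ffunP => k; rewrite skew_mulE (bigD1 k) //= !ffunE mulVg eqxx.
rewrite big1 ?addr0 // => h hk.
by rewrite ffunE -eq_mulVg1 (negPf hk) raddf0 mulr0.
Qed.

Lemma skew_eE g : skew_e G g = ((#|[set: elt G]|%:R)^-1)%:MP.
Proof.
rewrite /skew_e sum_ffunE (bigD1 g) //= ffunE eqxx big1 ?addr0 // => h /negPf hg.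
by rewrite ffunE eq_sym hg.
Qed.

Lemma cardG_neq0 : #|[set: elt G]|%:R != 0 :> K.
Proof. by rewrite (cardD1 1%g) inE. Qed.

Lemma const1_AeA : [ffun=> 1] \in AeA.
Proof.
have -> : [ffun=> 1] = delta (#|[set: elt G]|%:R)%:MP 1%g * skew_e G.
  apply/ffunP => g; rewrite delta1M !ffunE skew_eE -mpolyCM divff ?mpolyC1 //.
  exact: cardG_neq0.
by apply/asboolP; exists [:: (delta (#|[set: elt G]|%:R)%:MP 1%g, 1)];
  rewrite big_seq1 mulr1.
Qed.

(* Multiplying the constant function 1 on the left by [sym_act h b_h] and on the
   right by [b_h] gives two elements of [AeA]; their difference vanishes at [h]. *)
Lemma AeA_prod (b : elt G -> symV V) (r : seq (elt G)) :
  ([ffun g => \prod_(h <- r) (sym_act (val h) (b h) - sym_act (val g) (b h))]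
    : skew G) \in AeA.
Proof.
elim: r => [|h r IH].
  by rewrite (_ : [ffun g => _] = [ffun=> 1]) ?const1_AeA //;
    apply/ffunP => g; rewrite !ffunE big_nil.
set p : skew G := [ffun g => _] in IH.
have -> : [ffun g => \prod_(l <- h :: r)
                      (sym_act (val l) (b l) - sym_act (val g) (b l))]
    = delta (sym_act (val h) (b h)) 1%g * p - p * delta (b h) 1%g :> skew G.
  apply/ffunP => g; rewrite delta1M mul_delta1 !ffunE big_cons mulrBl.
  by rewrite [X in _ - X]mulrC.
by apply: rpredB; [apply: ideal2Ml|apply: ideal2Mr].
Qed.

(** For g != 1 the product of [AeA_prod] over all h != 1 has a zero factor at h = g, so only the
    coefficient at the identity survives. *)
Lemma AeA_delta_prod (b : elt G -> symV V) :
  (delta (\prod_(h : elt G | h != 1%g) (sym_act (val h) (b h) - b h)) 1%g : skew G)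
    \in AeA.
Proof.
have -> : delta (\prod_(h : elt G | h != 1%g) (sym_act (val h) (b h) - b h)) 1%g =
  [ffun g => \prod_(h <- enum [set h : elt G | h != 1%g])
     (sym_act (val h) (b h) - sym_act (val g) (b h))] :> skew G.
  apply/ffunP => g; rewrite !ffunE big_enum; under [RHS]eq_bigl do rewrite inE.
  case: eqP => [->|/eqP g1].
    by apply: eq_bigr => h _; rewrite sym_act_id.
  by rewrite (bigD1 g) //= subrr mul0r.
exact: AeA_prod.
Qed.

Lemma AeA_delta_conj f (g : elt G) :
  (delta f 1%g : skew G) \in AeA -> (delta (sym_act (val g) f) 1%g : skew G) \in AeA.
Proof.
move=> fA; have -> : delta (sym_act (val g) f) 1%g
    = delta 1 g * delta f 1%g * delta 1 g^-1%g.
  by rewrite !deltaM mulg1 mulgV rmorph1 mulr1 mul1r.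
by apply: ideal2Mr; apply: ideal2Ml.
Qed.

Lemma AeA_deltaM f h :
  (delta h 1%g : skew G) \in AeA -> (delta (f * h) 1%g : skew G) \in AeA.
Proof.
move=> hA; have -> : delta (f * h) 1%g = delta f 1%g * delta h 1%g :> skew G.
  by rewrite deltaM sym_act_id mulg1.
exact: ideal2Ml.
Qed.
End IdempotentIdeal.

(** * An invariant outside p that multiplies p into AeA *)

(** Modulo the ideal [P] the product is a power of ['X]. *)
Lemma coef_prod_XsubC_ideal (R : comNzRingType) (P : R -> Prop) (cs : seq R) (i : nat) :
    (forall a b, P a -> P b -> P (a + b)) -> (forall a b, P b -> P (a * b)) ->
    (forall c, c \in cs -> P c) -> (i < size cs)%N ->
  P (\prod_(c <- cs) ('X - c%:P))`_i.
Proof.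
move=> PD PM; elim: cs i => [//|c cs IH] i Pcs isz.
rewrite big_cons mulrBl coefB coefXM coefCM.
have PcM a : P (- (c * a)).
  by rewrite -mulNr -mulrN1 -mulrA mulrC; apply: PM; apply: Pcs; rewrite mem_head.
apply: PD => //; case: i isz => [_|i isz] /=.
  by have := PM 0 c (Pcs c (mem_head _ _)); rewrite mul0r.
by apply: IH => // d dcs; apply: Pcs; rewrite in_cons dcs orbT.
Qed.

Section GenericAnnihilator.
Variables (K : fieldType) (V : vectType K) (G : linGroup V) (v : V).
Variables (s : 'End(V)) (lam : K).
Hypothesis char0 : forall n, n.+1%:R != 0 :> K.
Hypotheses (v0 : v != 0) (sv : s v = lam *: v) (lam1 : lam != 1).
Hypothesis smod : trivial_mod v s.
Local Notation x := (sym1 v).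
Local Notation ev := (sym_act (mirror_proj s lam)).
Local Notation AeA := (gen_ideal2 (skew_e G)).
Local Notation W := (inertia G v).

(** For each exponent 0 < k < |W| some element of W has an eigenvalue c with c^k != 1, so
    [xdvd_jump] gains one more factor x. *)
Lemma inv_xdvd r m : (forall g : elt G, sym_act (val g) r = r) -> ev r = 0 ->
  (m <= #|W|)%N -> xdvd v m r.
Proof.
move=> rinv r0; elim: m => [_|m IH mW]; first exact: xdvd0.
case: m => [|m] in IH mW *; first by apply/(evP sv lam1 smod).
have [|g gI [c gv cm]] := @inertia_exists_neq1 _ _ G _ char0 v0 m.+1; first by [].
apply: (xdvd_jump v0 sv lam1 smod _ gv cm) => //; first exact/inertiaP.
by apply: IH; apply: ltnW.
Qed.

(** An element of W moves vectors only along [v], which gives exactly one factor x; any other [h]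
    moves some vector by one off this line, whose linear form is prime to x. *)
Lemma moving_factor (h : elt G) : h != 1%g -> exists b : V, exists2 u,
  sym1 (val h b - b) = u * x ^+ (h \in W) & ev u != 0.
Proof.
move=> h1; have [hI|hI] := boolP (h \in W).
  have [b hb] : exists b, val h b - b != 0.
    apply: contrapT => /forallNP none; case/eqP: h1; apply: val_inj.
    apply/lfunP => b; rewrite elt1E; apply/eqP; rewrite -subr_eq0.
    by apply/negPn/negP/none.
  have /inertiaP /(_ b) /vlineP [k kE] := hI.
  exists b, k%:MP; first by rewrite kE linearZ /= mul_mpolyC.
  rewrite /sym_act comp_mpolyC mpolyC_eq0.
  by apply: contraNneq hb => k0; rewrite kE k0 scale0r.
have /existsNP [b hb] : ~ trivial_mod v (val h) by apply/inertiaP.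
exists b, (sym1 (val h b - b)); first by rewrite mulr1.
rewrite sym_act1 sym1_eq0; apply/eqP => /(mirror_proj_eq0 lam1 smod).
exact: hb.
Qed.

Lemma moving_product : exists b : elt G -> V, exists2 u,
  \prod_(h : elt G | h != 1%g) (sym_act (val h) (sym1 (b h)) - sym1 (b h))
    = u * x ^+ #|W|.-1 & ev u != 0.
Proof.
have /choice [b bP] : forall h : elt G, exists b, h != 1%g ->
    exists2 u, sym1 (val h b - b) = u * x ^+ (h \in W) & ev u != 0.
  move=> h; have [->|/moving_factor [b bP]] := eqVneq h 1%g; first by exists 0.
  by exists b.
have /choice [u uP] : forall h : elt G, exists u, h != 1%g ->
    sym1 (val h (b h) - b h) = u * x ^+ (h \in W) /\ ev u != 0.
  move=> h; have [->|h1] := eqVneq h 1%g; first by exists 0.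
  by have [u uE u0] := bP h h1; exists u.
exists b, (\prod_(h : elt G | h != 1%g) u h); last first.
  by rewrite rmorph_prod; apply/prodf_neq0 => h /uP [].
transitivity (\prod_(h : elt G | h != 1%g) (u h * x ^+ (h \in W))).
  by apply: eq_bigr => h /uP [<- _]; rewrite sym_act1 linearB.
rewrite big_split /=; congr (_ * _); rewrite prodrXr; congr (_ ^+ _).
rewrite [in RHS](cardD1 1%g).
have -> : 1%g \in W by apply/inertiaP => b'; rewrite elt1E subrr mem0v.
rewrite add1n /= -sum1_card [RHS]big_mkcond [LHS]big_mkcond /=.
by apply: eq_bigr => h _; rewrite !inE; case: (h == 1%g) => //=; case: `[< _ >].
Qed.

Lemma exists_annihilator : exists q : symV V,
  [/\ forall g : elt G, sym_act (val g) q = q, ev q != 0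
    & forall r, (forall g : elt G, sym_act (val g) r = r) -> ev r = 0 ->
        (delta (q * r) 1%g : skew G) \in AeA].
Proof.
pose I f := forall r, (forall g : elt G, sym_act (val g) r = r) -> ev r = 0 ->
  (delta (f * r) 1%g : skew G) \in AeA.
have [b [u bE u0]] := moving_product.
have Iu : I u.
  (* The invariant [r] supplies the factor x^(|W| - 1) that completes [u] to the product lying in
     AeA. *)
  move=> r rinv r0; have [r' ->] := inv_xdvd rinv r0 (leq_pred _).
  rewrite mulrCA -bE.
  by apply/AeA_deltaM/AeA_delta_prod.
have ID f g : I f -> I g -> I (f + g).
  move=> If Ig r rinv r0; rewrite mulrDl.
  have -> : delta (f * r + g * r) 1%g = delta (f * r) 1%g + delta (g * r) 1%g :> skew G.
    by apply/ffunP => k; rewrite !ffunE; case: eqP; rewrite ?addr0.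
  by apply: rpredD; [apply: If|apply: Ig].
have IM f g : I g -> I (f * g).
  by move=> Ig r rinv r0; rewrite -mulrA; apply/AeA_deltaM/Ig.
have Iact f (g : elt G) : I f -> I (sym_act (val g) f).
  by move=> If r rinv r0; rewrite -[r](rinv g) -rmorphM; apply/AeA_delta_conj/If.
(* [u] is a root of the product of the ['X - g u], so some non-leading
   coefficient of it is prime to [x]; all of them are invariant and in [I]. *)
pose cs := [seq sym_act (val g) u | g <- enum [set: elt G]].
pose Q := \prod_(c <- cs) ('X - c%:P).
have Qinv (g : elt G) : map_poly (sym_act (val g)) Q = Q.
  rewrite /Q rmorph_prod /= !big_map !big_enum /=.
  under eq_bigl do rewrite in_setT; under [RHS]eq_bigl do rewrite in_setT.
  rewrite [RHS](reindex_inj (mulgI g)); apply: eq_bigr => h _ /=.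
  by rewrite rmorphB /= map_polyX map_polyC /= -sym_act_comp.
have [i ics ni] : exists2 i, (i < size cs)%N & ev Q`_i != 0.
  apply: contrapT => none; case/negP: u0.
  (* If every lower coefficient vanished modulo x, [Q] would reduce to a power of ['X] and its root
     [u] to zero. *)
  have QX : map_poly ev Q = 'X^(size cs).
    apply/polyP => i; rewrite coef_map coefXn.
    have [ics|] := ltnP i (size cs).
      rewrite (ltn_eqF ics); apply/eqP/negPn/negP => ni.
      by apply: none; exists i.
    rewrite leq_eqVlt => /orP [/eqP <-|ics].
      have /monicP : Q \is monic by apply: monic_prod_XsubC.
      by rewrite /lead_coef size_prod_XsubC /= => ->; rewrite rmorph1 eqxx.
    by rewrite nth_default ?size_prod_XsubC // raddf0 (gtn_eqF ics).
  have ucs : u \in cs.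
    by apply/mapP; exists 1%g; rewrite ?mem_enum ?in_setT // sym_act_id.
  have : root Q u by rewrite root_prod_XsubC.
  move/rootP/(congr1 ev); rewrite -horner_map /= QX rmorph0 hornerXn => /eqP.
  by rewrite expf_eq0 => /andP [].
exists Q`_i; split=> //.
  by move=> g; rewrite -[in RHS](Qinv g) coef_map.
apply: (coef_prod_XsubC_ideal ID IM) => // c /mapP [g _ ->].
exact: Iact.
Qed.
End GenericAnnihilator.

(** * The action of S*G on S and its graded pieces along the orbit *)

Section SkewAction.
Variables (K : fieldType) (V : vectType K) (G : linGroup V) (v : V).
Local Notation x := (sym1 v).
Implicit Types (a b : skew G) (f : symV V).

Definition act a f : symV V := \sum_(g : elt G) a g * sym_act (val g) f.

Lemma actM a b f : act (a * b) f = act a (act b f).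
Proof.
rewrite /act; under eq_bigr do rewrite skew_mulE mulr_suml.
rewrite exchange_big; apply: eq_bigr => h _ /=.
rewrite rmorph_sum mulr_sumr (reindex_inj (mulgI h)); apply: eq_bigr => k _ /=.
by rewrite mulKg rmorphM -mulrA sym_act_comp.
Qed.

Lemma actB a b f : act (a - b) f = act a f - act b f.
Proof. by rewrite -sumrB; apply: eq_bigr => g _; rewrite !ffunE mulrBl. Qed.

Lemma act_delta u g f : act (delta u g) f = u * sym_act (val g) f.
Proof.
rewrite /act (bigD1 g) //= ffunE eqxx big1 ?addr0 // => h /negPf hg.
by rewrite ffunE hg mul0r.
Qed.

Lemma actZ (r : invRing G) a f : act (r *: a) f = val r * act a f.
Proof. by rewrite mulr_sumr; apply: eq_bigr => g _; rewrite ffunE mulrA. Qed.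

Lemma act_e_inv f (g : elt G) : sym_act (val g) (act (skew_e G) f) = act (skew_e G) f.
Proof.
rewrite /act rmorph_sum [RHS](reindex_inj (mulgI g)); apply: eq_bigr => h _ /=.
by rewrite rmorphM /= !skew_eE [sym_act _ _%:MP]comp_mpolyC sym_act_comp.
Qed.

(* The [i]-th symbolic power of the radical ideal of the [G]-orbit of the
   hyperplane [x = 0]. *)
Definition orbit_power i f : Prop := forall g : elt G, xdvd v i (sym_act (val g) f).

Lemma orbit_power1 i f : orbit_power i f -> xdvd v i f.
Proof. by move/(_ 1%g); rewrite sym_act_id. Qed.

Lemma orbit_power_act i a f : orbit_power i f -> orbit_power i (act a f).
Proof.
move=> fi g; rewrite rmorph_sum; apply: xdvd_sum => h _.
rewrite rmorphM; apply: xdvdMl; rewrite /= -sym_act_comp.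
exact: (fi (g * h)%g).
Qed.

(* The annihilator of the [i]-th graded piece of this filtration. *)
Definition gr_ann i a : Prop :=
  forall f, orbit_power i f -> orbit_power i.+1 (act a f).

Lemma gr_annMl i a b : gr_ann i b -> gr_ann i (a * b).
Proof. by move=> bi f fi; rewrite actM; apply/orbit_power_act/bi. Qed.

Lemma gr_annMr i a b : gr_ann i a -> gr_ann i (a * b).
Proof. by move=> ai f fi; rewrite actM; apply/ai/orbit_power_act. Qed.

Lemma gr_annD i a b : gr_ann i a -> gr_ann i b -> gr_ann i (a + b).
Proof.
move=> ai bi f fi g.
have -> : act (a + b) f = act a f + act b f.
  by rewrite -big_split; apply: eq_bigr => h _; rewrite ffunE mulrDl.
by rewrite rmorphD; apply: xdvdD; [apply: ai|apply: bi].
Qed.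

Lemma gr_ann0 i : gr_ann i 0.
Proof.
move=> f _ g; rewrite /act big1 ?rmorph0 => [|h _]; last by rewrite ffunE mul0r.
exact: xdvd_zero.
Qed.

Lemma gr_ann_gen i a (r : seq (skew G * skew G)) :
  gr_ann i a -> gr_ann i (\sum_(p <- r) p.1 * a * p.2).
Proof.
move=> ai; elim/big_ind: _ => [|b c|p _]; [exact: gr_ann0|exact: gr_annD|].
exact/gr_annMr/gr_annMl.
Qed.

Lemma gr_ann_AeA i a : gr_ann i (skew_e G) -> a \in gen_ideal2 (skew_e G) -> gr_ann i a.
Proof. by move=> ei /asboolP [r ->]; apply: gr_ann_gen. Qed.

Variables (s : elt G) (lam : K).
Hypotheses (v0 : v != 0) (sv : val s v = lam *: v) (lam1 : lam != 1).
Hypothesis smod : trivial_mod v (val s).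
Local Notation ev := (sym_act (mirror_proj (val s) lam)).

(** The image of [e] is invariant, so divisibility need only be checked at x itself, where
    [xdvd_jump] applies to [s]. *)
Lemma gr_ann_e i : lam ^+ i != 1 -> gr_ann i (skew_e G).
Proof.
move=> lami f fi g; rewrite act_e_inv.
apply: (xdvd_jump v0 sv lam1 smod smod sv lami); first exact: act_e_inv.
exact/orbit_power1/orbit_power_act.
Qed.

Lemma gr_ann_cancel i (r : invRing G) a :
  ev (val r) != 0 -> gr_ann i (r *: a) -> gr_ann i a.
Proof.
move=> /eqP r0 rai f fi g; apply: (xdvd_cancel v0 sv lam1 smod r0).
by have := rai f fi g; rewrite actZ rmorphM /= sym_act_inv.
Qed.

(** The product of the translates of x not proportional to x: prime to x, yet zero on all other
    hyperplanes of the orbit. *)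
Definition other_mirrors : symV V :=
  \prod_(g : elt G | ev (sym_act (val g) x) != 0) sym_act (val g) x.
Local Notation u := other_mirrors.

Lemma ev_other_mirrors : ev u != 0.
Proof. by rewrite rmorph_prod; apply/prodf_neq0. Qed.

(** Either g^-1 x is a factor of [u], which [g] carries to x, or [g] preserves the line of [v]. *)
Lemma orbit_dichotomy (g : elt G) :
  xdvd v 1 (sym_act (val g) u) \/ exists c, val g v = c *: v.
Proof.
have gK : sym_act (val g) (sym_act (val (g^-1)%g) x) = x.
  by rewrite !sym_act1 -eltME mulgV elt1E.
have [|gx] := eqVneq (ev (sym_act (val (g^-1)%g) x)) 0; last first.
  left; rewrite /other_mirrors (bigD1 (g^-1)%g) //= rmorphM; apply: xdvdMr.
  by exists 1; rewrite mul1r expr1; apply: gK.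
rewrite !sym_act1 => /eqP; rewrite sym1_eq0 => /eqP /(mirror_proj_eq0 lam1 smod).
move=> /vlineP [k kE]; right; exists k^-1.
have vE : v = k *: val g v by rewrite -linearZ /= -kE -eltME mulgV elt1E.
rewrite {2}vE scalerK //; apply: contraNneq v0 => k0.
by rewrite vE k0 scale0r.
Qed.

Lemma xdvd_act_line i (g : 'End(V)) c f :
  g v = c *: v -> xdvd v i f -> xdvd v i (sym_act g f).
Proof.
move=> gv [h ->]; rewrite (sym_act_xX _ _ gv).
by exists ((c ^+ i)%:MP * sym_act g h).
Qed.

Lemma orbit_power_xu : orbit_power 1 (x * u).
Proof.
move=> g; rewrite rmorphM /=.
have [gu|[c gv]] := orbit_dichotomy g; first exact: xdvdMl.
by apply/xdvdMr/(xdvd_act_line gv); exists 1; rewrite mul1r expr1.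
Qed.

Lemma orbit_power_xu2 : orbit_power 2 ((x * u) ^+ 2).
Proof.
move=> g; rewrite rmorphXn expr2 -[2%N]/(1 + 1)%N.
by apply: xdvdM; apply: orbit_power_xu.
Qed.

(** Tested on x u: if x^2 divides r x u, then x divides r, being prime to u. *)
Lemma gr_ann1_scalar (r : invRing G) : gr_ann 1 (r *: 1) -> ev (val r) = 0.
Proof.
move=> /(_ _ orbit_power_xu)/orbit_power1; rewrite actZ [act 1 _]act_delta.
rewrite sym_act_id mul1r mulrC -mulrA mulrC -[x]expr1.
move=> /(xdvdS_expl v0 sv lam1 smod)/eqP; rewrite rmorphM mulf_eq0 /=.
by rewrite (negPf ev_other_mirrors) => /eqP.
Qed.

(* On the graded pieces 1 and 2, localised at [x], the reflection [s] acts by the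
   distinct scalars [lam] and [lam ^ 2]. *)
Definition separator : skew G := delta u 1%g * (delta 1 s - delta lam%:MP 1%g).

Lemma act_separator f : act separator f = u * (sym_act (val s) f - lam%:MP * f).
Proof. by rewrite actM actB !act_delta !sym_act_id !mul1r. Qed.

(** If x divides g u, the bracket gives a second factor x. Otherwise [g] preserves the line of [v],
    and s f = lam f modulo x^2. *)
Lemma gr_ann1_separator : gr_ann 1 separator.
Proof.
move=> f f1 g; rewrite act_separator.
have [gu|[c gv]] := orbit_dichotomy g.
  rewrite rmorphM -[2%N]/(1 + 1)%N; apply: xdvdM => //.
  rewrite rmorphB rmorphM /=; apply: xdvdD; last exact/xdvdN/xdvdMl/f1.
  by rewrite -sym_act_comp; apply: (f1 (g * s)%g).
apply: (xdvd_act_line gv); apply: xdvdMl.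
have [h fE] := orbit_power1 f1.
rewrite fE (sym_act_xX _ _ sv) expr1 mulrA -mulrBl -mulrBr.
apply/(xdvdS_expl v0 sv lam1 smod 1).
by rewrite rmorphM rmorphB /= (ev_act sv lam1 smod) // subrr mulr0.
Qed.

(** Tested on (x u)^2, which [s - lam] multiplies by lam^2 - lam modulo x^3; this scalar is nonzero
    as lam != 1 and [s] is invertible. *)
Lemma gr_ann2_separator : ~ gr_ann 2 separator.
Proof.
move=> /(_ _ orbit_power_xu2)/orbit_power1; rewrite act_separator.
rewrite exprMn mulrC [x ^+ 2 * _]mulrC (sym_act_xX _ _ sv).
rewrite [lam%:MP * _]mulrA -mulrBl mulrAC.
move=> /(xdvdS_expl v0 sv lam1 smod)/eqP.
rewrite rmorphM mulf_eq0 (negPf ev_other_mirrors) orbF rmorphB !rmorphM /=.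
rewrite !(ev_act sv lam1 smod) // ![sym_act _ _%:MP]comp_mpolyC -mulrBl.
rewrite !mulf_eq0 (negPf ev_other_mirrors) !orbF -mpolyCM -mpolyCB mpolyC_eq0.
rewrite -{3}[lam]mulr1 -mulrBr mulf_eq0 subr_eq0 (negPf lam1) orbF.
move=> /eqP l0; case/negP: v0; rewrite -[v](eltK s) sv l0 scale0r linear0.
exact: eqxx.
Qed.
End SkewAction.

(** * Classes in A/AeA *)

Section Abar.
Variables (K : fieldType) (V : vectType K) (G : linGroup V).

Definition abar (a : skew G) : Abar G :=
  rclass (Ideal2.clone (skew G) (gen_ideal2 (skew_e G)) _) a.

Lemma abar_eq a b : abar a = abar b <-> a - b \in gen_ideal2 (skew_e G).
Proof. by split=> [/rclassP //|ab]; apply/rclassP. Qed.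

Lemma abar_surj (y : Abar G) : exists a, y = abar a.
Proof. by exists (rrepr y); rewrite [RHS]rreprK. Qed.

Lemma abar1 : abar 1 = 1. Proof. by []. Qed.

Lemma abar0 : abar 0 = 0. Proof. exact: raddf0. Qed.

Lemma abarD a b : abar (a + b) = abar a + abar b.
Proof. exact: raddfD. Qed.

Lemma abarM a b : abar (a * b) = abar a * abar b.
Proof. exact: rmorphM. Qed.

Lemma abarZ (r : invRing G) a : abar (r *: a) = r *: abar a.
Proof. exact: rclassZ. Qed.

Lemma abar_sum_surj (a : skew G) (r : seq (Abar G * Abar G)) :
  exists t : seq (skew G * skew G),
    \sum_(p <- r) p.1 * abar a * p.2 = abar (\sum_(p <- t) p.1 * a * p.2).
Proof.
elim: r => [|[y z] r [t tE]]; first by exists [::]; rewrite !big_nil abar0.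
have [[b ->] [c ->]] := (abar_surj y, abar_surj z).
by exists ((b, c) :: t); rewrite !big_cons abarD !abarM tE.
Qed.
End Abar.

(** * Contradiction with generic simplicity *)

Section NotEnd.
Variables (K : fieldType) (V : vectType K) (G : linGroup V).
Variables (L : {vspace V} -> V) (M : lmodType (disc_ring G L)).
Variables (v : V) (s : elt G) (lam : K).
Hypothesis char0 : forall n, n.+1%:R != 0 :> K.
Hypotheses (v0 : v != 0) (sv : val s v = lam *: v).
Hypotheses (lam1 : lam != 1) (lam2 : lam ^+ 2 != 1).
Hypothesis smod : trivial_mod v (val s).
Local Notation ev := (sym_act (mirror_proj (val s) lam)).

Lemma Abar_not_End : finitely_generated M -> ~ disc_alg_iso M.
Proof.
move=> Mfg [phi [[psi phiK psiK] phiZ]].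
have [q0 [q0inv q0ev q0ann]] := exists_annihilator G char0 v0 sv lam1 smod.
have inv_of (f : symV V) :
    (forall g : elt G, sym_act (val g) f = f) -> f \in Defs.invariant G.
  by move=> finv; apply/forallP => g; rewrite finv.
pose q : invRing G := InvRing (inv_of _ q0inv).
have actE (r : invRing G) (m : M) :
    disc_class L r *: m = lend_fun (phi (r *: (1 : Abar G))) m.
  by rewrite phiZ rmorph1 lend_funZ lend_fun1.
have e1 : gr_ann v 1 (skew_e G) by apply: (gr_ann_e v0 sv lam1).
have e2 : gr_ann v 2 (skew_e G) by apply: (gr_ann_e v0 sv lam1).
have classM (a b : invRing G) : disc_class L (a * b) = disc_class L a * disc_class L b.
  exact: rmorphM.
have class_surj (c : disc_ring G L) : exists r, c = disc_class L r.
  by exists (rrepr c); rewrite [RHS]rreprK.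
(* [ann] is p: if q r vanishes in A/AeA, it kills the first graded piece, so q r and hence r lies in
   p. The converse is the choice of [q0]. *)
have annP (r : invRing G) : ann M (disc_class L q) (disc_class L r) <-> ev (val r) = 0.
  have -> : ann M (disc_class L q) (disc_class L r) <->
      ((q * r) *: (1 : skew G)) \in gen_ideal2 (skew_e G).
    rewrite -[_ *: _]subr0 -abar_eq abarZ abar1 abar0; split=> [h|h m].
      apply: (can_inj phiK); rewrite raddf0; apply: lendP => m.
      by rewrite lend_fun0 -actE classM.
    by rewrite -classM actE h raddf0 lend_fun0.
  split=> [/(gr_ann_AeA e1)/(gr_ann1_scalar v0 sv lam1 smod)/eqP|r0].
    have -> : val (q * r) = q0 * val r by [].
    by rewrite rmorphM mulf_eq0 /= (negPf q0ev) => /eqP.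
  have -> : (q * r) *: (1 : skew G) = delta (q0 * val r) 1%g.
    by apply/ffunP => g; rewrite !ffunE; case: eqP => _; rewrite ?mulr1 ?mulr0.
  by apply: q0ann => // g; apply: sym_act_inv.
have ann_prime (a b : disc_ring G L) :
    ann M (disc_class L q) (a * b) ->
  ann M (disc_class L q) a \/ ann M (disc_class L q) b.
  have [[a' ->] [b' ->]] := (class_surj a, class_surj b).
  rewrite -classM !annP.
  have -> : val (a' * b') = val a' * val b' by [].
  rewrite rmorphM => /eqP; rewrite mulf_eq0 => /orP.
  by case=> /eqP; [left|right].
have q_nann : ~ ann M (disc_class L q) (disc_class L q) by rewrite annP; apply/eqP.
pose zeta := separator v s lam.
have [[c nc]|[c nc]] :=
  @lend_generically_simple _ M _ ann_prime q_nann (phi (abar zeta)) Mfg.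
  (* Torsion case: a multiple of [zeta] by [r] outside p lies in AeA, so [zeta] would kill the
     second graded piece. *)
  have [r rE] := class_surj c; rewrite rE annP in nc *.
  rewrite -phiZ -abarZ => /eqP; rewrite -(raddf0 phi) => /eqP/(can_inj phiK).
  rewrite -abar0 => /abar_eq; rewrite subr0 => /(gr_ann_AeA e2).
  move/eqP: nc => nc /(gr_ann_cancel v0 sv lam1 smod nc).
  exact: (gr_ann2_separator v0 sv lam1 smod).
(* Scalar case: modulo AeA, [r] lies in the ideal of [zeta], so it kills the first graded piece and
   would lie in p. *)
have [r rE] := class_surj c; rewrite rE annP in nc *; case=> t tE.
apply: nc; apply: (gr_ann1_scalar v0 sv lam1 smod).
have [t' t'E] := abar_sum_surj zeta [seq (psi p.1, psi p.2) | p <- t].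
have : abar (r *: 1) = abar (\sum_(p <- t') p.1 * zeta * p.2).
  rewrite -t'E big_map /=; apply: (can_inj phiK).
  rewrite abarZ phiZ abar1 rmorph1 tE raddf_sum; apply: eq_bigr => p _ /=.
  by rewrite !rmorphM /= !psiK.
move=> /abar_eq /(gr_ann_AeA e1) h.
rewrite -[r *: 1](subrK (\sum_(p <- t') p.1 * zeta * p.2)).
by apply: gr_annD => //; apply/gr_ann_gen/gr_ann1_separator.
Qed.
End NotEnd.

(** * Eigenvalues of a reflection of order at least 3, and the conclusion *)

Section EigenData.
Variables (K : fieldType) (V : vectType K) (G : linGroup V).

Lemma reflection_eigen (s : elt G) : s \in reflections G -> (3 <= #[s]%g)%N ->
  exists (v : V) (lam : K), [/\ v != 0, val s v = lam *: v, lam != 1, lam ^+ 2 != 1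
    & trivial_mod v (val s)].
Proof.
rewrite inE => /asboolP [lam [v [b [vb lam1 _ sv sb]]]] s3.
have vmem w : exists k u, [/\ w = k *: v + u & val s u = u].
  have : w \in <<v :: b>>%VS by rewrite (span_basis vb) memvf.
  rewrite span_cons => /memv_addP [_ /vlineP [k ->] [u ub ->]].
  exists k, u; split=> //.
  have : (<<b>> <= fixedSpace (val s))%VS.
    by apply/span_subvP => y yb; apply/fixedSpaceP/sb.
  by move=> /subvP /(_ u ub) /fixedSpaceP.
exists v, lam; split=> //.
- apply: contraTneq (basis_free vb) => ->; rewrite free_cons.
  by rewrite mem0v.
(* If lam^2 = 1, then [s] squares to the identity on [v] and on the mirror, so its order divides
   2. *)
- apply: contraTneq s3 => lam2; rewrite -ltnNge ltnS; apply: dvdn_leq => //.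
  rewrite order_dvdn; apply/eqP/val_inj/lfunP => w.
  have [k [u [-> su]]] := vmem w.
  rewrite expgS expg1 eltME elt1E !linearD !linearZ /= sv su linearZ /= sv.
  by rewrite [lam *: (lam *: v)]scalerA -expr2 lam2 scale1r su.
move=> w; have [k [u [-> su]]] := vmem w.
rewrite linearD linearZ /= sv su opprD addrACA subrr addr0 scalerA -scalerBl.
by rewrite memvZ ?memv_line.
Qed.
End EigenData.

Theorem corollary3p23 (R : realType) (V : vectType R[i]) (G : linGroup V)
    (L : {vspace V} -> V)
    (G_gen : <<reflections G>>%g = [set: elt G])
    (G_ord3 : exists2 s : elt G, s \in reflections G & (3 <= #[s]%g)%N)
    (L_mirror : mirror_vectors G L) :
  ~ exists M : lmodType (disc_ring G L),
      finitely_generated M /\ disc_alg_iso M.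
Proof.
case=> M [Mfg]; have [s sR s3] := G_ord3.
have [v [lam [v0 sv lam1 lam2 smod]]] := reflection_eigen sR s3.
apply: (Abar_not_End _ v0 sv lam1 lam2 smod Mfg) => n.
by rewrite Num.Theory.pnatr_eq0.
Qed.
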